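(* Let $0<c<1$ be a real number and let $k(n)=c\cdot n$ for all $n\in\mathbb{N}^+$. Then there exists a set of points $S\subseteq\mathbb{N}^+\times\mathbb{N}^+$ such that $$\liminf_{n\to\infty}\frac{|S\cap[1,n]^2|}{k(n)\cdot n}=1$$ and, for every $n\in\mathbb{N}^+$, each line in the plane contains at most $k(n)$ points of $S\cap[1,n]^2$.
   Context: $\mathbb{N}^+$ denotes the positive integers. $[1,n]^2$ denotes the set of lattice points $(x,y)\in\mathbb{Z}^2$ with $1\le x\le n$ and $1\le y\le n$. ''Line'' means any straight line in $\mathbb{R}^2$ (of arbitrary slope, including vertical lines). *)

(* Defs.v *)
From mathcomp Require Import all_boot all_order all_algebra finmap.
From mathcomp Require Import all_classical all_reals all_analysis.
Set Implicit Arguments.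
Unset Strict Implicit.
Unset Printing Implicit Defensive.
Import Order.TTheory GRing.Theory Num.Theory.
Local Open Scope classical_set_scope.
Local Open Scope ring_scope.

Definition is_line (R : realType) (L : set (R * R)) : Prop :=
  exists a b d : R,
    (a, b) <> (0, 0) /\ L = [set p | a * p.1 + b * p.2 = d].

Definition to_plane (R : realType) (p : nat * nat) : R * R :=
  (p.1%:R, p.2%:R).

Definition positive_points : set (nat * nat) :=
  [set p | (0 < p.1)%N /\ (0 < p.2)%N].

Definition grid (n : nat) : set (nat * nat) :=
  [set p | (1 <= p.1 <= n)%N /\ (1 <= p.2 <= n)%N].

(* [fset_set] sends infinite sets to the empty set; [npoints] is only applied
   to subsets of a [grid], which are finite by [finite_sub_grid]. *)
Definition npoints (A : set (nat * nat)) : nat := #|` fset_set A|.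

Lemma finite_sub_grid (n : nat) (A : set (nat * nat)) :
  A `<=` grid n -> finite_set A.
Proof.
move=> AG; apply: (@sub_finite_set _ _ (`I_n.+1 `*` `I_n.+1)).
  by move=> p /AG [/andP[_ ?] /andP[_ ?]]; split; rewrite /= ltnS.
by apply: finite_setX; exact: finite_II.
Qed.

(* Main.v *)
Require Import Defs.
From mathcomp Require Import all_boot all_order all_algebra finmap.
From mathcomp Require Import all_classical all_reals all_analysis.
From mathcomp Require Import zify ring lra.
Set Implicit Arguments.
Unset Strict Implicit.
Unset Printing Implicit Defensive.
Import Order.TTheory GRing.Theory Num.Theory.
Local Open Scope classical_set_scope.
Local Open Scope ring_scope.

(** A point (x, y) is selected by looking at the base-p digits of the single
integer z = x + b * y, for a fixed prime p and a fixed multiplier b.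

For fixed j put q = p ^ j and select the points for which the reversal of the
last j digits of z is smaller than a, the largest integer below c * q.  Moving
along a line by a lattice vector (u, v) changes z by u + b * v; if p does not
divide this number, then any q consecutive lattice points of the line meet every
residue modulo q once, so exactly a of them are selected.  A line with at most n
lattice points in the square then has at most (n / q + 1) * a selected points,
which is at most c * n once n is large, because a / q < c strictly.  This
handles every direction for which p does not divide u + b * v, and b and p can
be chosen so that this covers all primitive (u, v) with entries at most H
([exists_separating]).  The remaining directions are harmless: a line with a
primitive direction longer than H has at most n / (H + 1) + 1 lattice points in
the square, which is at most c * n as soon as c * (H + 1) > 1 and n is large.
[collinear_npoints] is this dichotomy.

A fixed j only gives density a / q < c, so j has to grow with the point.
Reversing the digits makes this painless: the points selected at level j are
still selected at level j + 1 ([rev_digits_nested]), since the leading digits of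
the reversal do not change and p * a_j <= a_(j+1) ([quota_submul]).  So a point
is put in S when it is selected at some level j whose starting size N_j does not
exceed max(x, y).  Inside the square of side n, every point of S is then selected
at the one level J that is the largest with N_J <= n ([layered_set_top]), and
the bound above applies at level J to all of them at once.

For the density, each row of the square contains about a_j * n / q points
selected at level j, and only the rows below N_j can lose them; so the lower
limit of |S cap [1,n]^2| / (c * n ^ 2) is at least a_j / (c * q) for each j
([layered_set_ge]), which tends to 1.  The same row count at level J bounds the
ratio by 1, so it converges to 1. *)

(** * Counting lattice points by injections *)

(** Every upper bound below comes from an injective coding of the points.  The
set may be infinite: [npoints] is then 0. *)
Lemma npoints_le_size (K : eqType) (A : set (nat * nat)) (f : nat * nat -> K)
    (s : seq K) :
  (forall P, A P -> f P \in s) ->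
  (forall P P', A P -> A P' -> f P = f P' -> P = P') ->
  (npoints A <= size s)%N.
Proof.
move=> fs fI; rewrite /npoints.
have [fA|nfA] := pselect (finite_set A); last first.
  by rewrite /fset_set; case: pselect => // _; rewrite cardfs0.
have memA P : P \in fset_set A -> A P by rewrite in_fset_set // inE.
rewrite cardfE cardE -(size_map (f \o val)).
apply: uniq_leq_size.
  rewrite map_inj_uniq ?enum_uniq // => P P' /= /fI e.
  by apply/val_inj/e; exact/memA/valP.
by move=> _ /mapP[P _ ->] /=; exact/fs/memA/valP.
Qed.

Lemma npoints_split (A B : set (nat * nat)) : finite_set A ->
  (npoints A <= npoints (A `&` B) + npoints (A `\` B))%N.
Proof.
move=> fA.
have fI : finite_set (A `&` B) by apply: sub_finite_set fA => P [].
have fD : finite_set (A `\` B) by apply: sub_finite_set fA => P [].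
rewrite /npoints -size_cat; apply: uniq_leq_size; first exact: fset_uniq.
move=> P; rewrite mem_cat !in_fset_set // !inE => AP.
by have [BP|nBP] := pselect (B P); apply/orP; [left|right]; rewrite inE.
Qed.

Lemma grid_npoints (n : nat) : (n * n <= npoints (grid n))%N.
Proof.
rewrite -[n in leqLHS](size_iota 1 n) -(size_allpairs pair).
apply: uniq_leq_size.
  by apply: allpairs_uniq; rewrite ?iota_uniq // => -[x y] [x' y'] _ _ [-> ->].
move=> _ /allpairsP[[x y] /= [+ + ->]]; rewrite !mem_iota => hx hy.
rewrite in_fset_set; last exact: (@finite_sub_grid n).
by rewrite inE; split => /=; lia.
Qed.

(** * Digit reversal *)

(** Reading the last [j] digits of [z] backwards, with the units digit becoming
the leading one, makes the value at level [j.+1] refine the value at level [j];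
[z %% p ^ j] itself has no such monotonicity. *)
Fixpoint rev_digits (p j z : nat) : nat :=
  if j is i.+1 then (p * rev_digits p i z + (z %/ p ^ i) %% p)%N else 0%N.

Lemma rev_digits_lt (p j z : nat) : (0 < p)%N -> (rev_digits p j z < p ^ j)%N.
Proof.
move=> p0; elim: j => [|j IH] /=; first by rewrite expn0.
rewrite expnS; have := ltn_pmod (z %/ p ^ j) p0; nia.
Qed.

Lemma rev_digits_inj (p j z z' : nat) : (0 < p)%N ->
  rev_digits p j z = rev_digits p j z' -> z = z' %[mod p ^ j].
Proof.
move=> p0; elim: j => [|j IH] /= e; first by rewrite expn0 !modn1.
have h := ltn_pmod (z %/ p ^ j) p0; have h' := ltn_pmod (z' %/ p ^ j) p0.
have e1 : rev_digits p j z = rev_digits p j z' by nia.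
have e2 : ((z %/ p ^ j) %% p = (z' %/ p ^ j) %% p)%N by move: e; rewrite e1; lia.
have {}IH := IH e1.
have dig t : (t %% p ^ j.+1 = (t %/ p ^ j) %% p * p ^ j + t %% p ^ j)%N.
  rewrite modn_divl -expnS {1}(divn_eq (t %% p ^ j.+1)%N (p ^ j)%N).
  by rewrite modn_dvdm // expnS dvdn_mull.
by rewrite !dig e2 IH.
Qed.

(** One more level multiplies the reversal by [p] and adds a digit below [p], so
being below [a j] gives being below [p * a j]. *)
Lemma rev_digits_nested (p : nat) (a : nat -> nat) (i j z : nat) : (0 < p)%N ->
  (forall j, p * a j <= a j.+1)%N -> (i <= j)%N ->
  (rev_digits p i z < a i)%N -> (rev_digits p j z < a j)%N.
Proof.
move=> p0 amono ij hi; elim: j ij => [|j IH].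
  by rewrite leqn0 => /eqP i0; rewrite -i0.
rewrite leq_eqVlt => /orP[/eqP <- //|]; rewrite ltnS => /IH hj /=.
have := amono j; have := ltn_pmod (z %/ p ^ j) p0; nia.
Qed.

(** * Selected points on a line *)

Definition shear (b : nat) (P : nat * nat) : nat := (P.1 + b * P.2)%N.

Lemma same_block (q m m' : nat) : (0 < q)%N ->
  (m %/ q = m' %/ q)%N -> `|m%:Z - m'%:Z| < q%:Z.
Proof.
move=> q0 e; have := divn_eq m q; have := divn_eq m' q.
have := ltn_pmod m q0; have := ltn_pmod m' q0; rewrite e; lia.
Qed.

Lemma primitive_direction (x y : int) : x <> 0 \/ y <> 0 ->
  exists d u v s t : int, [/\ d <> 0, x = d * u, y = d * v & s * u + t * v = 1].
Proof.
move=> xy0; have [s [t st]] := Bezoutz x y.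
have /dvdzP[u xE] := dvdz_gcdl x y; have /dvdzP[v yE] := dvdz_gcdr x y.
have d0 : gcdz x y <> 0.
  by move=> d0; move: xE yE; rewrite d0 !mulr0 => x0 y0; case: xy0.
move: (gcdz x y) st xE yE d0 => d st xE yE d0.
exists d, u, v, s, t; split; rewrite 1?[d * _]mulrC //.
apply: (@mulIf _ d); first exact/eqP.
by rewrite mul1r -[RHS]st xE yE; ring.
Qed.

(** The relation [s * u + t * v = 1] is how primitivity of [(u, v)] is carried
around; the multiple is [m = s * x + t * y]. *)
Lemma parallel_multiple (x y u v s t : int) :
  s * u + t * v = 1 -> u * y = v * x ->
  exists m : int, x = m * u /\ y = m * v.
Proof.
move=> st e; exists (s * x + t * y); split.
  by rewrite -[LHS]mul1r -st; transitivity (s * u * x + t * (v * x));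
    [ring|rewrite -e; ring].
by rewrite -[LHS]mul1r -st; transitivity (s * (u * y) + t * v * y);
    [ring|rewrite e; ring].
Qed.

Lemma norm_le_normM (x y : int) : x * y <> 0 -> `|x| <= `|x * y|.
Proof.
move=> /eqP; rewrite mulf_eq0 negb_or => /andP[_ y0].
by rewrite normrM ler_peMr // -gtz0_ge1 normr_gt0.
Qed.

(** [shear b] moves by [u + b * v] along the vector [(u, v)]; this asks that no
short nonzero vector be invisible modulo [p]. *)
Definition separates (p b H : nat) : Prop :=
  forall u v : int, `|u| <= H%:Z -> `|v| <= H%:Z ->
    (p%:Z %| u + b%:Z * v)%Z -> u = 0 /\ v = 0.

(** With [b > H] the value [u + b * v] vanishes only at [u = v = 0] among short
vectors, and a prime larger than all these values cannot divide a nonzero one. *)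
Lemma exists_separating (H : nat) :
  exists p b : nat, prime p /\ separates p b H.
Proof.
have [p Hp pp] := prime_above (H + H.+1 * H)%N.
exists p, H.+1; split=> // u v uH vH /dvdzP[k e].
have k0 : k = 0 by nia.
move: e; rewrite k0 mul0r => e.
have v0 : v = 0 by nia.
by move: e; rewrite v0; lia.
Qed.

(** Here [g] is the coordinate that varies most along the line.  Code a point by
the block of length [p ^ j] containing its [g]-coordinate and by its reversed
digits.  If this is injective, the first bound holds.  A collision is a
difference [d * (u, v)], with [(u, v)] primitive, along which [shear b] is
constant modulo [p ^ j] although [0 < |d| < p ^ j]; so [p] divides [u + b * v],
the direction [(u, v)] is long, and distinct lattice points of the line differ
by more than [H] in the [g]-coordinate, which is the second bound. *)
Lemma collinear_npoints (p b H j a n : nat) (Q : set (nat * nat))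
    (g : nat * nat -> nat) :
  prime p -> separates p b H ->
  (forall P, Q P -> (g P <= n)%N) ->
  (forall P P', Q P -> Q P' ->
     `|P.1%:Z - P'.1%:Z| <= `|(g P)%:Z - (g P')%:Z| /\
     `|P.2%:Z - P'.2%:Z| <= `|(g P)%:Z - (g P')%:Z|) ->
  (forall P P' T T', Q P -> Q P' -> Q T -> Q T' ->
     (P.1%:Z - P'.1%:Z) * (T.2%:Z - T'.2%:Z) =
     (P.2%:Z - P'.2%:Z) * (T.1%:Z - T'.1%:Z)) ->
  (forall P, Q P -> (rev_digits p j (shear b P) < a)%N) ->
  (npoints Q <= (n %/ p ^ j).+1 * a)%N \/ (npoints Q <= (n %/ H.+1).+1)%N.
Proof.
move=> pp sep gn dom col reva.
have p0 := prime_gt0 pp.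
have q0 : (0 < p ^ j)%N by rewrite expn_gt0 p0.
pose f P := ((g P %/ p ^ j)%N, rev_digits p j (shear b P)).
have [finj|] := pselect (forall P P', Q P -> Q P' -> f P = f P' -> P = P').
  left; rewrite -[(n %/ _).+1](size_iota 0) -[a in leqRHS](size_iota 0).
  rewrite -(size_allpairs pair); apply: (npoints_le_size (f := f)) => // P QP.
  rewrite allpairs_f ?mem_iota //= add0n; last exact: reva.
  by rewrite ltnS leq_div2r // gn.
move=> /existsNP[P] /existsNP[P'] /not_implyP[QP] /not_implyP[QP'].
move=> /not_implyP[[eblk erev] neP]; right.
have [bx by_] := dom _ _ QP QP'.
have blk := same_block q0 eblk.
have dxy : P.1%:Z - P'.1%:Z <> 0 \/ P.2%:Z - P'.2%:Z <> 0.
  have [e1|] := pselect (P.1%:Z - P'.1%:Z = 0); last by left.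
  right=> e2; apply: neP; move: e1 e2; clear.
  by case: P P' => [x y] [x' y'] /= e1 e2; congr pair; lia.
have [d [u [v [s [t [d0 xE yE st]]]]]] := primitive_direction dxy.
have dq : `|d| < (p ^ j)%N%:Z by case: dxy;
  [rewrite xE in bx *|rewrite yE in by_ *] => /norm_le_normM h;
  apply: le_lt_trans (le_trans h _) blk.
have qdvd : ((p ^ j)%N%:Z %| d * (u + b%:Z * v))%Z.
  rewrite mulrDr mulrCA -xE -yE.
  have -> : P.1%:Z - P'.1%:Z + b%:Z * (P.2%:Z - P'.2%:Z) =
            (shear b P)%:Z - (shear b P')%:Z by rewrite /shear; lia.
  by rewrite -eqz_mod_dvd !modz_nat; exact/eqP/congr1/(rev_digits_inj p0 erev).
(* A short direction would make [u + b * v] prime to [p], and then [p ^ j]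
   would divide [d]. *)
have long : H%:Z < `|u| \/ H%:Z < `|v|.
  have [uH|] := leP `|u| H%:Z; last by left.
  have [vH|] := leP `|v| H%:Z; last by right.
  have npuv : ~~ (p%:Z %| u + b%:Z * v)%Z.
    apply/negP => /(sep _ _ uH vH)[u0 v0].
    by move: st; rewrite u0 v0 !mulr0 addr0.
  move: qdvd; rewrite dvdzE abszM Gauss_dvdl; last first.
    by rewrite absz_nat coprimeXl // prime_coprime // -dvdzE.
  by rewrite absz_nat => /dvdn_leq; move: d0 dq; clear; lia.
rewrite -[(n %/ _).+1](size_iota 0).
apply: (npoints_le_size (f := fun P => (g P %/ H.+1)%N)) => [T QT|T T' QT QT' e].
  by rewrite mem_iota /= add0n ltnS leq_div2r // gn.
have tblk := same_block (ltn0Sn H) e; have [tx ty] := dom _ _ QT QT'.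
have ueq : u * (T.2%:Z - T'.2%:Z) = v * (T.1%:Z - T'.1%:Z).
  apply: (@mulfI _ d); first exact/eqP.
  by rewrite !mulrA -xE -yE; exact: col.
have [m [txE tyE]] := parallel_multiple st ueq.
have m0 : m = 0.
  have [//|/eqP m0] := eqVneq m 0; rewrite txE in tx; rewrite tyE in ty.
  have small w : `|m * w| <= `|(g T)%:Z - (g T')%:Z| -> ~ H%:Z < `|w|.
    move=> mw Hw; have w0 : w != 0 by rewrite -normr_gt0 (le_lt_trans _ Hw).
    have mw0 : w * m <> 0 by apply/eqP; rewrite mulf_neq0 //; exact/eqP.
    have := norm_le_normM mw0; rewrite mulrC => /le_trans/(_ mw).
    by move=> /(lt_le_trans Hw); move: tblk; clear; lia.
  by case: long => [/(small _ tx)|/(small _ ty)].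
move: txE tyE; rewrite m0 !mul0r; clear.
by case: T T' => [x y] [x' y'] /= ex ey; congr pair; lia.
Qed.

(** The coordinate [g] is [fst] on lines of slope at most 1 in absolute value,
and [snd] on the others. *)
Lemma lattice_line (R : realType) (L : set (R * R)) : is_line L ->
  exists g : nat * nat -> nat,
  [/\ (forall P, g P <= maxn P.1 P.2)%N,
      forall P P', L (to_plane R P) -> L (to_plane R P') ->
        `|P.1%:Z - P'.1%:Z| <= `|(g P)%:Z - (g P')%:Z| /\
        `|P.2%:Z - P'.2%:Z| <= `|(g P)%:Z - (g P')%:Z| &
      forall P P' T T', L (to_plane R P) -> L (to_plane R P') ->
        L (to_plane R T) -> L (to_plane R T') ->
        (P.1%:Z - P'.1%:Z) * (T.2%:Z - T'.2%:Z) =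
        (P.2%:Z - P'.2%:Z) * (T.1%:Z - T'.1%:Z)].
Proof.
move=> [a [b [d [ab0 ->]]]].
pose dx (P P' : nat * nat) : int := P.1%:Z - P'.1%:Z.
pose dy (P P' : nat * nat) : int := P.2%:Z - P'.2%:Z.
have dir P P' : a * P.1%:R + b * P.2%:R = d -> a * P'.1%:R + b * P'.2%:R = d ->
    a * (dx P P')%:~R + b * (dy P P')%:~R = 0.
  by move=> e e'; rewrite /dx /dy !intrB -!pmulrn; lra.
have par P P' T T' : a * P.1%:R + b * P.2%:R = d ->
    a * P'.1%:R + b * P'.2%:R = d -> a * T.1%:R + b * T.2%:R = d ->
    a * T'.1%:R + b * T'.2%:R = d -> dx P P' * dy T T' = dy P P' * dx T T'.
  move=> /dir eP /eP{}eP /dir eT /eT{}eT; apply: (@intr_inj R).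
  rewrite !intrM; apply/eqP; rewrite -subr_eq0; move: eP eT.
  move: (dx P P')%:~R (dy P P')%:~R (dx T T')%:~R (dy T T')%:~R => x y x' y' eP eT.
  have [a0|a0] := eqVneq a 0.
    have b0 : b != 0 by apply/eqP => b0; apply: ab0; rewrite a0 b0.
    move: eP eT; rewrite a0 !mul0r !add0r => /eqP + /eqP.
    by rewrite !mulf_eq0 (negPf b0) /= => /eqP -> /eqP ->; rewrite mulr0 mul0r subrr.
  have ex : a * x = - (b * y) by lra.
  have ex' : a * x' = - (b * y') by lra.
  suff : a * (x * y' - y * x') = 0 by move/eqP; rewrite mulf_eq0 (negPf a0).
  transitivity ((a * x) * y' - y * (a * x')); first by ring.
  by rewrite ex ex'; ring.
have [leab|/ltW leba] := leP `|a| `|b|.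
- exists fst; split=> [P|P P' e e'|]; rewrite ?leq_maxl //; split=> //.
  have b0 : 0 < `|b|.
    rewrite normr_gt0; apply/eqP => b0; apply: ab0; congr pair => //.
    by apply/eqP; rewrite -normr_le0 (le_trans leab) // b0 normr0.
  rewrite -(ler_int R) !intr_norm -(ler_pM2l b0) -!normrM.
  have -> : b * (dy P P')%:~R = - (a * (dx P P')%:~R).
    by apply/eqP; rewrite -addr_eq0 addrC; apply/eqP/dir.
  by rewrite normrN !normrM ler_wpM2r.
- exists snd; split=> [P|P P' e e'|]; rewrite ?leq_maxr //; split=> //.
  have a0 : 0 < `|a|.
    rewrite normr_gt0; apply/eqP => a0; apply: ab0; congr pair => //.
    by apply/eqP; rewrite -normr_le0 (le_trans leba) // a0 normr0.
  rewrite -(ler_int R) !intr_norm -(ler_pM2l a0) -!normrM.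
  have -> : a * (dx P P')%:~R = - (b * (dy P P')%:~R).
    by apply/eqP; rewrite -addr_eq0; apply/eqP/dir.
  by rewrite normrN !normrM ler_wpM2r.
Qed.

(** * Quotas and starting sizes *)

(** The largest integer strictly below [x], for [0 < x].  Strictness is what
leaves room for the incomplete last block in [eventually_few]. *)
Definition quota (R : realType) (x : R) : nat := `|Num.ceil x|.-1.

Lemma quota_itv (R : realType) (x : R) : 0 < x ->
  (quota x)%:R < x /\ x <= (quota x).+1%:R.
Proof.
move=> x0; have /andP[] := ceil_itv x; rewrite /quota.
have := x0; rewrite -ceil_gt0; case: (Num.ceil x) => // -[|m] // _.
move=> lo hi; split; last by move: hi; rewrite -pmulrn.
by move: lo; rewrite intrB -!pmulrn -natr1 addrK.
Qed.

Lemma quota_submul (R : realType) (c : R) (p j : nat) : 0 < c -> (0 < p)%N ->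
  (p * quota (c * (p ^ j)%:R) <= quota (c * (p ^ j.+1)%:R))%N.
Proof.
move=> c0 p0.
have q0 i : 0 < c * (p ^ i)%:R by rewrite mulr_gt0 // ltr0n expn_gt0 p0.
have [lo _] := quota_itv (q0 j); have [_ hi] := quota_itv (q0 j.+1).
rewrite -ltnS -(ltr_nat R); apply: lt_le_trans hi.
by rewrite expnS !natrM mulrCA ltr_pM2l // ltr0n.
Qed.

(** The full blocks contain [n * (a / q)] points, which is below [c * n] by an
amount proportional to [n]; this absorbs the [a] points of the last block. *)
Lemma eventually_few (R : realType) (c : R) (q a : nat) : (0 < q)%N ->
  a%:R < c * q%:R ->
  exists N, forall n, (N <= n)%N -> ((n %/ q).+1 * a)%:R <= c * n%:R.
Proof.
move=> q0 acq.
have [N HN] : exists N : nat, (a * q)%:R / (c * q%:R - a%:R) < N%:R.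
  by eexists; exact: unstable.ltr_bound.
exists N => n Nn.
rewrite ltr_pdivrMr ?subr_gt0 // in HN.
have {}HN : (a * q)%:R <= n%:R * (c * q%:R - a%:R).
  by rewrite (le_trans (ltW HN)) // ler_wpM2r ?ler_nat // subr_ge0 ltW.
have qR : 0 < q%:R :> R by rewrite ltr0n.
rewrite -(ler_pM2r qR).
have : ((n %/ q * q) * a)%:R <= (n * a)%:R :> R by rewrite ler_nat leq_mul2r leq_divM orbT.
move: HN; rewrite mulSn !natrD !natrM; lra.
Qed.

(** * The layered set *)

Definition layered_set (p b : nat) (a N : nat -> nat) : set (nat * nat) :=
  [set P | (0 < P.1)%N /\ (0 < P.2)%N /\ exists j,
    (N j <= maxn P.1 P.2)%N /\ (rev_digits p j (shear b P) < a j)%N].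

(** Levels grow with the side of the square, so by nesting the highest level
available in the square contains all lower ones. *)
Lemma layered_set_top (p b : nat) (a N : nat -> nat) (n : nat) : (0 < p)%N ->
  (forall j, p * a j <= a j.+1)%N -> (forall j, j <= N j)%N ->
  layered_set p b a N `&` grid n = set0 \/
  exists2 J, (N J <= n)%N & forall P, (layered_set p b a N `&` grid n) P ->
    (rev_digits p J (shear b P) < a J)%N.
Proof.
move=> p0 amono jN.
have level P : (layered_set p b a N `&` grid n) P -> exists j,
    (N j <= n)%N /\ (rev_digits p j (shear b P) < a j)%N.
  move=> [[_ [_ [j [Nj rj]]]] [/andP[_ x] /andP[_ y]]].
  by exists j; split=> //; rewrite (leq_trans Nj) // geq_max x.
have [[j0 Nj0]|none] := pselect (exists j, (N j <= n)%N); last first.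
  left; rewrite -subset0 => P /level[j [Nj _]]; by apply: none; exists j.
have bnd j : (N j <= n)%N -> (j <= n)%N by exact: leq_trans.
have [J NJ maxJ] := ex_maxnP (ex_intro (fun j => (N j <= n)%N) _ Nj0) bnd.
right; exists J => // P /level[j [Nj]].
by apply: rev_digits_nested => //; exact: maxJ.
Qed.

(** In a row, [shear b] runs through consecutive integers, so a block of length
[p ^ j] contains at most [a] points with reversed digits in a window of length
[a].  The lower end [lo] is arbitrary so that the count applies to the selected
points as well as to the unselected ones. *)
Lemma rows_npoints (p b j n lo a : nat) (A : set (nat * nat)) : (0 < p)%N ->
  A `<=` grid n ->
  (forall P, A P -> lo <= rev_digits p j (shear b P) < lo + a)%N ->
  (npoints A <= n * ((n %/ p ^ j).+1 * a))%N.
Proof.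
move=> p0 AG revA.
pose f P := (P.2, (P.1 %/ p ^ j, rev_digits p j (shear b P)))%N.
pose blocks := iota 0 (n %/ p ^ j).+1.
have <- : size (allpairs pair (iota 1 n) (allpairs pair blocks (iota lo a))) =
    (n * ((n %/ p ^ j).+1 * a))%N by rewrite !size_allpairs !size_iota.
apply: (npoints_le_size (f := f)) => [P AP|].
  have [/andP[x1 xn] /andP[y1 yn]] := AG _ AP.
  by rewrite !allpairs_f ?mem_iota ?revA ?add1n ?ltnS ?y1 ?leq_div2r.
move=> [x y] [x' y'] _ _ [/= <- ediv /(rev_digits_inj p0) /eqP].
rewrite /shear /= eqn_modDr => /eqP emod; congr pair.
by rewrite (divn_eq x (p ^ j)) (divn_eq x' (p ^ j)) ediv emod.
Qed.

(** A grid point outside the set lies in one of the first [N j] rows or has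
reversed digits at least [a j]; the latter are counted by [rows_npoints]. *)
Lemma layered_set_ge (p b : nat) (a N : nat -> nat) (j n : nat) : (0 < p)%N ->
  (a j <= p ^ j)%N ->
  (n * n <= npoints (layered_set p b a N `&` grid n) + n * N j
            + n * ((n %/ p ^ j).+1 * (p ^ j - a j)))%N.
Proof.
move=> p0 aq; set S := layered_set p b a N.
have fG : finite_set (grid n) by exact: (@finite_sub_grid n).
apply: leq_trans (grid_npoints n) _.
apply: leq_trans (npoints_split S fG) _.
rewrite setIC -addnA leq_add2l.
pose low : set (nat * nat) := [set P | (P.2 < N j)%N].
apply: leq_trans (npoints_split low _) _; first by apply: sub_finite_set fG => P [].
apply: leq_add.
  rewrite -[n in leqRHS](size_iota 1) -[N j](size_iota 0) -(size_allpairs pair).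
  apply: (npoints_le_size (f := id)) => // -[x y] [[[/= x1n _] _] ylow].
  by rewrite allpairs_f ?mem_iota ?add1n.
apply: (rows_npoints (b := b) (lo := a j)) => // [P [[]]//|P [[GP nSP] hiP]].
rewrite subnKC // rev_digits_lt // andbT leqNgt; apply/negP => rP.
have [/andP[x1 _] /andP[y1 _]] := GP.
apply: nSP; split=> //; split=> //; exists j; split=> //.
by rewrite leq_max; apply/orP; right; move/negP: hiP; rewrite -leqNgt.
Qed.

(** * Line bound and density of the layered set *)

Theorem theorem1p4 (R : realType) (c : R) (c_gt0 : 0 < c) (c_lt1 : c < 1)
    (k : nat -> R) (kE : forall n : nat, (0 < n)%N -> k n = c * n%:R) :
  exists S : set (nat * nat),
    [/\ S `<=` positive_points,
        limn_einf (fun n : nat =>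
          ((npoints (S `&` grid n))%:R / (k n * n%:R))%:E) = 1%E
      & forall n : nat, (0 < n)%N ->
          forall L : set (R * R), is_line L ->
            (npoints (S `&` grid n `&` [set p | L (to_plane R p)]))%:R <= k n].
Proof.
(* Lattice points of a line that are more than [H] apart have density below
   [c], selected or not. *)
have [H cH] : exists H : nat, c^-1 < H%:R by eexists; exact: unstable.ltr_bound.
have {}cH : 1%:R < c * H.+1%:R.
  by rewrite mulrC -ltr_pdivrMr // div1r (lt_trans cH) // ltr_nat.
have [p [b [pp sep]]] := exists_separating H.
have p0 := prime_gt0 pp; have p1 := prime_gt1 pp.
have q0 j : (0 < p ^ j)%N by rewrite expn_gt0 p0.
have qR j : 0 < (p ^ j)%:R :> R by rewrite ltr0n.
have cq0 j : 0 < c * (p ^ j)%:R by rewrite mulr_gt0.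
pose a j := quota (c * (p ^ j)%:R).
have a_lt j : (a j)%:R < c * (p ^ j)%:R by have [] := quota_itv (cq0 j).
have a_ge j : c * (p ^ j)%:R <= (a j)%:R + 1 by have [_] := quota_itv (cq0 j); rewrite -natr1.
have a_le j : (a j <= p ^ j)%N.
  rewrite -(ler_nat R); apply: le_trans (ltW (a_lt j)) _.
  by rewrite ler_piMl ?(ltW (qR j)) // ltW.
have amono j : (p * a j <= a j.+1)%N by exact: quota_submul.
(* The condition [j <= N] makes only finitely many levels active in a square.
   The bound for long directions is the case [a = 1], [q = H.+1]. *)
have level j : exists N, (j <= N)%N /\ forall n, (N <= n)%N ->
    ((n %/ p ^ j).+1 * a j)%:R <= c * n%:R /\ (n %/ H.+1).+1%:R <= c * n%:R.
  have [N1 HN1] := eventually_few (q0 j) (a_lt j).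
  have [N2 HN2] := eventually_few (ltn0Sn H) cH.
  exists (j + (N1 + N2))%N; split=> [|n Nn]; first by rewrite leq_addr.
  by split; [apply: HN1|rewrite -[_.+1]muln1; apply: HN2]; lia.
have [N NP] := choice level.
pose S := layered_set p b a N.
have top n := layered_set_top b n p0 amono (fun j => (NP j).1).
have npoints0 A : A = set0 -> npoints A = 0%N.
  by move=> ->; rewrite /npoints fset_set0 cardfs0.
exists S; split.
- by move=> P [? []].
- pose s n := npoints (S `&` grid n).
  have s_le n : (s n)%:R <= c * n%:R * n%:R.
    have [/npoints0 e|[J NJ revJ]] := top n.
      by rewrite /s e !mulr_ge0 // ltW.
    have SG : S `&` grid n `<=` grid n by move=> P [].
    have := rows_npoints (lo := 0) p0 SG revJ.
    rewrite -(ler_nat R) => /le_trans; apply.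
    by rewrite natrM mulrC ler_wpM2r //; have [] := (NP J).2 n NJ.
  have s_ge j n : (0 < n)%N ->
      (c - (p ^ j)%:R^-1) * n%:R * n%:R <= (s n)%:R + (N j + p ^ j)%:R * n%:R.
    move=> n0; have := layered_set_ge b N n p0 (a_le j).
    rewrite -(ler_nat R) !natrD !natrM -/S -/(s n) natrB // -natr1.
    have nq : (n %/ p ^ j)%:R * (p ^ j)%:R <= n%:R :> R.
      by rewrite -natrM ler_nat leq_divM.
    have aq : (a j)%:R <= (p ^ j)%:R :> R by rewrite ler_nat.
    have n0' : 0 < n%:R :> R by rewrite ltr0n.
    have hv : (p ^ j)%:R * (p ^ j)%:R^-1 = 1 :> R by rewrite divff // gt_eqF.
    have v0 : 0 < (p ^ j)%:R^-1 :> R by rewrite invr_gt0.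
    have := a_ge j; have a0 : 0 <= (a j)%:R :> R by [].
    move: (qR j) nq aq n0' hv v0 a0.
    move: (a j)%:R (p ^ j)%:R (n %/ p ^ j)%:R (n%:R) (_^-1) => A q d m v q_gt0 dq Aq m0 qv v0 A0 Acq tot.
    have dv : d <= m * v by rewrite -[d]mulr1 -qv mulrA ler_pM2r.
    have cv : c - v <= v * A.
      have := ler_wpM2l (ltW v0) Acq; rewrite mulrDr mulr1 mulrCA [v * q]mulrC qv; lra.
    have blk : d * (q - A) <= m - m * (v * A).
      apply: le_trans (_ : m * v * (q - A) <= _).
        by rewrite ler_wpM2r ?subr_ge0.
      by rewrite mulrBr -!mulrA [v * q]mulrC qv mulr1.
    have := ler_wpM2l (ltW m0) blk.
    have := ler_wpM2l (ltW (mulr_gt0 m0 m0)) cv.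
    have := mulr_ge0 (ltW m0) A0.
    move: tot; lra.
  apply: (cvg_limn_einf_sup _).1.
  apply/fine_cvgP; split; first exact: nearW.
  apply/cvgrPdist_le => e e0.
  (* At level [j] the density falls short of [c] by at most [p ^ j]^-1; the first
     rows and the incomplete blocks cost a further [O(n)] points. *)
  have [j hj] : exists j, (p ^ j)%:R^-1 <= c * (e / 2).
    exists (Num.bound (c * (e / 2))^-1).
    rewrite -[leRHS]invrK lef_pV2 ?posrE ?invr_gt0 // ?mulr_gt0 // ?divr_gt0 //.
    apply: (le_trans (ltW (unstable.ltr_bound _))).
    by rewrite ler_nat ltnW // ltn_expl.
  have [M hM] : exists M : nat, (N j + p ^ j)%:R / (c * (e / 2)) < M%:R.
    by eexists; exact: unstable.ltr_bound.
  exists M.+1 => // n /= Mn.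
  have n0 : (0 < n)%N by exact: leq_trans Mn.
  have n0' : 0 < n%:R :> R by rewrite ltr0n.
  have kn0 : 0 < c * n%:R * n%:R by rewrite !mulr_gt0.
  rewrite kE // distrC ler_distl ler_pdivlMr // ler_pdivrMr //.
  have ce0 : 0 < c * (e / 2) by rewrite mulr_gt0 // divr_gt0.
  have hn : (N j + p ^ j)%:R <= c * (e / 2) * n%:R.
    rewrite mulrC -ler_pdivrMr //; apply: (le_trans (ltW hM)).
    by rewrite ler_nat ltnW.
  have nn0 := ltW (mulr_gt0 n0' n0').
  have := s_ge j n n0; have := ler_wpM2r (ltW n0') hn; have := ler_wpM2r nn0 hj.
  have := s_le n; have := mulr_ge0 (ltW e0) (ltW kn0).
  by rewrite /s => *; apply/andP; split; lra.
- move=> n n0 L /lattice_line[g [g_le dom col]]; rewrite kE //.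
  have [e|[J NJ revJ]] := top n.
    by rewrite npoints0 ?e ?set0I // mulr_ge0 // ltW.
  have [few_blocks few_far] := (NP J).2 n NJ.
  have [] := @collinear_npoints p b H J (a J) n
      (S `&` grid n `&` [set P | L (to_plane R P)]) g pp sep.
  + move=> P [[_ [/andP[_ x] /andP[_ y]]] _].
    by rewrite (leq_trans (g_le P)) // geq_max x.
  + by move=> P P' [_ LP] [_ LP']; exact: dom.
  + by move=> P P' T T' [_ ?] [_ ?] [_ ?] [_ ?]; exact: col.
  + by move=> P [SP _]; exact: revJ.
  + by rewrite -(ler_nat R) => /le_trans; apply.
  + by rewrite -(ler_nat R) => /le_trans; apply.
Qed.
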